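(* Let $X$ be a Banach space and let $\mathcal{F},\mathcal{G}$ be regular thin families. If $o(\mathcal{F})=o(\mathcal{G})$, then $(e_n)_{n}$ is an $\mathcal{F}$-spreading model of $X$ if and only if $(e_n)_n$ is a $\mathcal{G}$-spreading model of $X$. More generally, if $o(\mathcal{F})\le o(\mathcal{G})$ and $(e_n)_n$ is an $\mathcal{F}$-spreading model of $X$, then $(e_n)_n$ is a $\mathcal{G}$-spreading model of $X$.
   Context: $\mathbb{N}=\{1,2,\dots\}$; $[M]^\infty$ is the set of infinite subsets of $M$. For $M\subseteq\mathbb{N}$ infinite, $M(k)$ is its $k$-th element; for a finite set $s$, $s(k)$ is its $k$-th element; $t\sqsubseteq s$ means initial segment. For a family $\mathcal{F}$ of finite subsets of $\mathbb{N}$ let $\widehat{\mathcal{F}}=\{t:\exists s\in\mathcal{F},\ t\sqsubseteq s\}$ and $\mathcal{F}\upharpoonright M=\{s\in\mathcal{F}:s\subseteq M\}$. $\mathcal{F}$ is thin if no element is a proper initial segment of another. A family is regular if it is hereditary (closed under subsets), spreading (if $\{n_1<\dots<n_k\}$ is in it, $m_1<\dots<m_k$, $n_i\le m_i$ for all $i$, then $\{m_1,\dots,m_k\}$ is in it) and compact (its characteristic functions form a closed subset of $\{0,1\}^{\mathbb{N}}$). $\mathcal{F}$ is regular thin if it is thin and $\widehat{\mathcal{F}}$ is regular; regular thin families are assumed to contain a nonempty set. The order $o(\mathcal{F})$ is the (countable) rank of the well-founded tree $\widehat{\mathcal{F}}$: maximal elements of $\widehat{\mathcal{F}}$ have rank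 $0$, the rank of $s$ is $\sup\{\mathrm{rank}(t)+1: t\in\widehat{\mathcal{F}},\ s\sqsubset t\}$, and $o(\mathcal{F})$ is the rank of $\emptyset$. A tuple $(s_1,\dots,s_l)$ of nonempty finite subsets of $\mathbb{N}$ is plegma if $s_i(k)<s_j(k)$ whenever $i<j$ and $k\le\min(|s_i|,|s_j|)$, and $s_i(k)<s_j(k+1)$ for all $i,j$ and $k\le\min(|s_i|,|s_j|-1)$. An $\mathcal{F}$-sequence $(x_s)_{s\in\mathcal{F}}$ in $X$ is a map $s\mapsto x_s$ from $\mathcal{F}$ to $X$; its restrictions $(x_s)_{s\in\mathcal{F}\upharpoonright M}$, $M\in[\mathbb{N}]^\infty$, are its $\mathcal{F}$-subsequences. Let $(e_n)_n$ be a Hamel basis of an infinite-dimensional seminormed space $(E,\|\cdot\|_* )$. $(x_s)_{s\in\mathcal{F}\upharpoonright M}$ generates $(e_n)_n$ as an $\mathcal{F}$-spreading model if there is a null sequence $(\delta_n)_n$ of positive reals such that $\big|\,\|\sum_{j=1}^k a_jx_{s_j}\|-\|\sum_{j=1}^k a_je_j\|_*\big|\le\delta_l$ for all $1\le k\le l$, all plegma $k$-tuples $(s_j)_{j=1}^k$ in $\mathcal{F}\upharpoonright M$ with $s_1(1)\ge M(l)$ and all $a_1,\dots,a_k\in[-1,1]$. $(e_n)_n$ is an $\mathcal{F}$-spreading model of $X$ if some $\mathcal{F}$-subsequence in $X$ generates it. *)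

(* Defs.v *)
From mathcomp Require Import all_boot all_order all_algebra finmap.
From mathcomp Require Import all_classical all_reals all_analysis.
Import Order.TTheory GRing.Theory Num.Theory numFieldNormedType.Exports.

Set Implicit Arguments.
Unset Strict Implicit.
Unset Printing Implicit Defensive.

Local Open Scope classical_set_scope.

(* Convention: the positive integers {1, 2, ...} are represented by nat through
   the order isomorphism n |-> n - 1; only their order is ever used.  Positions
   and indices are accordingly counted from 0: the k-th elements s(k) and M(k)
   are [elt s k.-1] and [enumset M k.-1]. *)

Definition elt (s : {fset nat}) (k : nat) : nat := nth 0 (sort leq s) k.

Definition min_of (A : set nat) : nat :=
  xget 0 [set m | A m /\ forall n, A n -> (m <= n)%N].

(* This is the increasing enumeration when M is infinite; junk otherwise. *)
Fixpoint enumset (M : set nat) (k : nat) : nat :=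
  if k is k'.+1 then min_of (M `&` [set n | (enumset M k' < n)%N])
  else min_of M.

Definition initial_segment (t s : {fset nat}) : Prop :=
  (t `<=` s)%fset /\
  forall m n, m \in t -> n \in s -> (n <= m)%N -> n \in t.

Definition proper_initial (t s : {fset nat}) : Prop :=
  initial_segment t s /\ t <> s.

Definition set_family := set {fset nat}.

Definition hat (F : set_family) : set_family :=
  [set t | exists2 s, F s & initial_segment t s].

Definition restrict_family (F : set_family) (M : set nat) : set_family :=
  [set s | F s /\ [set` s] `<=` M].

Definition thin (F : set_family) : Prop :=
  forall s t, F s -> F t -> ~ proper_initial s t.

Definition hereditary (F : set_family) : Prop :=
  forall s t, F s -> (t `<=` s)%fset -> F t.

Definition spreading (F : set_family) : Prop :=
  forall s t, F s -> #|` t| = #|` s| ->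
    (forall k, (k < #|` s|)%N -> (elt s k <= elt t k)%N) -> F t.

Definition indicator_fset (s : {fset nat}) : cantor_space :=
  fun n => n \in s.

Definition compact_family (F : set_family) : Prop :=
  closed [set indicator_fset s | s in F].

Definition regular_family (F : set_family) : Prop :=
  [/\ hereditary F, spreading F & compact_family F].

Definition regular_thin (F : set_family) : Prop :=
  [/\ thin F, regular_family (hat F) & exists2 s, F s & s <> fset0].

(* Ordinals as well-founded trees: [Sup1 f] denotes sup_i (f i + 1).  An
   ordinal has many representations, so equality of ordinals is [ord_eq]. *)
Inductive ord : Type := Sup1 (T : Type) (f : T -> ord).

(* sup_i (f i + 1) <= b iff f i < b for all i, and
   f i < sup_j (g j + 1) iff f i <= g j for some j. *)
Fixpoint ord_le (a b : ord) : Prop :=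
  match a, b with
  | Sup1 T f, Sup1 U g => forall i : T, exists j : U, ord_le (f i) (g j)
  end.

Definition ord_eq (a b : ord) : Prop := ord_le a b /\ ord_le b a.

Definition extends_in (F : set_family) (t s : {fset nat}) : Prop :=
  hat F t /\ proper_initial s t.

Lemma regular_thin_wf (F : set_family) :
  regular_thin F -> well_founded (extends_in F).
Proof.
move=> [_ [_ _ cF] _] s0; apply: contrapT => nacc0.
have step (s : {s | ~ Acc (extends_in F) s}) :
    {t : {s | ~ Acc (extends_in F) s} | extends_in F (sval t) (sval s)}.
  apply: cid; apply: contrapT => H; apply: (svalP s); constructor => t ts.
  by apply: contrapT => nt; apply: H; exists (exist _ t nt).
pose u n := iter n (fun s => sval (step s)) (exist _ s0 nacc0).
pose v n := sval (u n.+1).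
have cv n : extends_in F (v n.+1) (v n) by exact: (svalP (step (u n.+1))).
have hv n : hat F (v n) by case: (svalP (step (u n))).
have sub m n : (m <= n)%N -> (v m `<=` v n)%fset.
  move=> /subnK <-; elim: (n - m)%N => [|k IH]; first exact: fsubset_refl.
  by apply: (fsubset_trans IH); case: (cv (k + m)%N) => _ [[]].
have card n : (n <= #|` v n|)%N.
  elim: n => // n IH; apply: (leq_ltn_trans IH); apply: fproper_ltn_card.
  rewrite fproperEneq (sub n n.+1) // andbT.
  by case: (cv n) => _ [_ /eqP].
pose A : cantor_space := fun n => `[< exists k, n \in v k >].
have cvA : (indicator_fset \o v) n @[n --> \oo] --> A.
  apply/cvg_sup => i U [/= _ [[B /= oB <- /= BA]]] /filterS; apply.
  have /= nb : \forall n \near \oo, indicator_fset (v n) i = A i.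
    case: (asboolP (exists k, i \in v k)) => [[k ik]|nk].
      exists k => // n /= kn.
      rewrite /indicator_fset (fsubsetP (sub _ _ kn)) //.
      by symmetry; apply/asboolP; exists k.
    exists 0%N => // n _; rewrite /indicator_fset /A asboolF //.
    by apply/negP => H; apply: nk; exists n.
  by apply: filterS nb => n /= nb; rewrite nb.
have [s hs sA] : [set indicator_fset s | s in hat F] A.
  apply: (closed_cvg _ cF _ _ cvA).
  by exists 0%N => // n _; exists (v n).
have vs n : (v n `<=` s)%fset.
  apply/fsubsetP => i iv.
  have : indicator_fset s i by rewrite sA; apply/asboolP; exists n.
  by [].
have := fsubset_leq_card (vs #|` s|.+1).
by rewrite leqNgt => /negP; apply; exact: card.
Qed.

Definition node_rank (F : set_family) (hF : regular_thin F) :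
    {fset nat} -> ord :=
  Fix (regular_thin_wf hF) (fun=> ord)
    (fun s rk =>
       Sup1 (fun t : {t | extends_in F t s} => rk (sval t) (svalP t))).

Lemma node_rankE (F : set_family) (hF : regular_thin F) (s : {fset nat}) :
  node_rank hF s =
    Sup1 (fun t : {t | extends_in F t s} => node_rank hF (sval t)).
Proof.
rewrite /node_rank Fix_eq // => r f g fg; congr Sup1.
by apply/funext => t; exact: fg.
Qed.

Definition o_rank (F : set_family) (hF : regular_thin F) : ord :=
  node_rank hF fset0.

Definition plegma (k : nat) (s : 'I_k -> {fset nat}) : Prop :=
  [/\ forall i, s i <> fset0,
      forall (i j : 'I_k) m, (i < j)%N -> (m < #|` s i|)%N ->
        (m < #|` s j|)%N -> (elt (s i) m < elt (s j) m)%N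
    & forall (i j : 'I_k) m, (m < #|` s i|)%N -> (m.+1 < #|` s j|)%N ->
        (elt (s i) m < elt (s j) m.+1)%N].

Local Open Scope ring_scope.

Definition seminorm (R : realType) (E : lmodType R) (nu : E -> R) : Prop :=
  [/\ forall x, 0 <= nu x,
      forall x y, nu (x + y) <= nu x + nu y
    & forall (a : R) x, nu (a *: x) = `|a| * nu x].

(* A Hamel basis indexed by nat is infinite, so E is infinite-dimensional. *)
Definition hamel_basis (R : realType) (E : lmodType R) (e : nat -> E) : Prop :=
  (forall n (a : 'I_n -> R), \sum_(i < n) a i *: e i = 0 -> forall i, a i = 0)
  /\ (forall v, exists n (a : 'I_n -> R), v = \sum_(i < n) a i *: e i).

(* The tuple length k + 1 and the index l + 1 of the usual formulation
   (1 <= k + 1 <= l + 1) are written k.+1 and l.  Only the values of x on F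
   matter. *)
Definition generates (R : realType) (X : normedModType R) (E : lmodType R)
    (nu : E -> R) (e : nat -> E) (F : set_family) (M : set nat)
    (x : {fset nat} -> X) : Prop :=
  exists delta : nat -> R,
    [/\ forall l, 0 < delta l,
        delta n @[n --> \oo] --> (0 : R)
      & forall (k l : nat), (k <= l)%N ->
          forall s : 'I_k.+1 -> {fset nat},
            plegma s -> (forall j, restrict_family F M (s j)) ->
            (enumset M l <= elt (s ord0) 0)%N ->
          forall a : 'I_k.+1 -> R, (forall j, -1 <= a j <= 1) ->
            `| `|\sum_j a j *: x (s j)| - nu (\sum_j a j *: e j) |
              <= delta l].

Definition spreading_model (R : realType) (X : normedModType R)
    (E : lmodType R) (nu : E -> R) (e : nat -> E) (F : set_family) : Prop :=
  exists (x : {fset nat} -> X) (M : set nat),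
    infinite_set M /\ generates nu e F M x.

(* Main.v *)
(* The rank comparison yields an increasing map L with L(s) in hat G for every s
   in hat F: well-founded induction gives such maps above each one-point
   extension, and since hat G is spreading one increasing map dominating them
   diagonally serves for all.  Next, thin M out to a set M' inside which every
   finite set has an initial segment in F or is a non-maximal element of hat F.
   If t in G is contained in L(M'), then the second alternative is excluded for
   the set L^-1(t), for otherwise t would be a proper initial segment of an
   element of hat G; so t has an initial segment L(s_t) with s_t in F.  Put
   y_t = x_{s_t}.  Since (s_t) is plegma whenever (t) is, (y_t) generates the
   same spreading model as (x_s). *)
Require Import Defs.
From mathcomp Require Import all_boot all_order all_algebra finmap.
From mathcomp Require Import all_classical all_reals all_analysis.

Set Implicit Arguments.
Unset Strict Implicit.
Unset Printing Implicit Defensive.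

Local Open Scope classical_set_scope.

(** * Finite sets as strictly increasing lists *)

Local Notation fs l := [fset x in l : seq nat]%fset.
Local Notation sq s := (sort leq (enum_fset s)).

Lemma in_fset_seq (l : seq nat) x : (x \in fs l) = (x \in l).
Proof. by rewrite inE. Qed.

Lemma sort_fset_sorted (s : {fset nat}) : sorted ltn (sq s).
Proof.
by rewrite ltn_sorted_uniq_leq sort_uniq fset_uniq sort_sorted //; exact: leq_total.
Qed.

Lemma fset_sortK (s : {fset nat}) : fs (sq s) = s.
Proof. by apply/fsetP => x; rewrite in_fset_seq mem_sort. Qed.

Lemma sort_fset_seq (l : seq nat) : sorted ltn l -> sq (fs l) = l.
Proof.
move=> sl; apply: (irr_sorted_eq ltn_trans ltnn) => //.
  exact: sort_fset_sorted.
by move=> x; rewrite mem_sort in_fset_seq.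
Qed.

Lemma card_fset_seq (l : seq nat) : sorted ltn l -> #|` fs l| = size l.
Proof. by move=> sl; rewrite -[in RHS](sort_fset_seq sl) size_sort. Qed.

Lemma elt_fset_seq (l : seq nat) k : sorted ltn l -> elt (fs l) k = nth 0 l k.
Proof. by move=> sl; rewrite /elt sort_fset_seq. Qed.

Lemma initial_segment_cat (p q : seq nat) :
  sorted ltn (p ++ q) -> initial_segment (fs p) (fs (p ++ q)).
Proof.
rewrite (sorted_pairwise ltn_trans) pairwise_cat => /and3P[/allrelP pq _ _].
split; first by apply/fsubsetP => x; rewrite !in_fset_seq mem_cat => ->.
move=> m n; rewrite !in_fset_seq mem_cat => mp /orP[//|nq].
by rewrite leqNgt (pq _ _ mp nq).
Qed.

(** Initial segments thus become list prefixes. The tail lists the elements of [s] outside [t], all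
    of which exceed those of [t]. *)
Lemma sort_initial_segment (t s : {fset nat}) :
  initial_segment t s -> exists q, sq s = sq t ++ q.
Proof.
move=> [/fsubsetP ts init]; exists [seq x <- sq s | x \notin t].
apply: (irr_sorted_eq ltn_trans ltnn); first exact: sort_fset_sorted.
  have := sort_fset_sorted s; have := sort_fset_sorted t.
  rewrite !(sorted_pairwise ltn_trans) pairwise_cat => -> ps.
  rewrite (subseq_pairwise (filter_subseq _ _) ps) !andbT.
  apply/allrelP => m n; rewrite mem_filter !mem_sort => mt /andP[nt ns].
  by rewrite ltnNge; apply: contra nt; exact: (init m).
move=> x; rewrite mem_cat mem_filter !mem_sort.
by case: (boolP (x \in t)) => //= /ts.
Qed.

Lemma initial_segment_trans (a b c : {fset nat}) :
  initial_segment a b -> initial_segment b c -> initial_segment a c.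
Proof.
move=> [ab ia] [bc ib]; split; first exact: fsubset_trans bc.
move=> m n ma nc nm; apply: (ia m) => //.
by apply: (ib m) => //; exact: (fsubsetP ab).
Qed.

Lemma hat_sub (F : set_family) (p q : seq nat) : hereditary (hat F) ->
  {subset p <= q} -> hat F (fs q) -> hat F (fs p).
Proof.
move=> hF pq hq; apply: hF hq _; apply/fsubsetP => x; rewrite !in_fset_seq; exact: pq.
Qed.

Lemma hat_spread (F : set_family) (p q : seq nat) : spreading (hat F) ->
  sorted ltn p -> sorted ltn q -> size q = size p ->
  (forall k, k < size p -> nth 0 p k <= nth 0 q k)%N ->
  hat F (fs p) -> hat F (fs q).
Proof.
move=> spF sp sq_ szq le_pq; move/spF; apply; first by rewrite !card_fset_seq.
by move=> k; rewrite card_fset_seq // !elt_fset_seq //; exact: le_pq.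
Qed.

(** * The shift [L] obtained from the rank comparison *)

Lemma increasing_majorant (h : nat -> nat) :
  exists2 L : nat -> nat, {homo L : i j / (i < j)%N} &
    forall k, (h k <= L k)%N.
Proof.
exists (fun k => \sum_(i < k.+1) (h i).+1)%N => [|k].
  apply: (homo_ltn ltn_trans) => i.
  by rewrite [ltnRHS]big_ord_recr /= -addSnnS leq_addr.
by rewrite big_ord_recr /=; apply: leq_trans (leqnSn _) (leq_addl _ _).
Qed.

(** The rank of [t] extended by [n] is bounded by that of some [w] properly extending [u], and
    induction gives a map above [w]. Only the first new entry of [w] is kept, so that lengths agree
    and spreading applies. *)
Lemma shift_of_node_rank_le (F G : set_family)
    (hF : regular_thin F) (hG : regular_thin G) (t : {fset nat}) (u : seq nat) :
  sorted ltn u -> hat G (fs u) ->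
  ord_le (node_rank hF t) (node_rank hG (fs u)) ->
  exists2 L : nat -> nat, {homo L : i j / (i < j)%N} &
    forall q, sorted ltn (sq t ++ q) -> hat F (fs (sq t ++ q)) ->
      sorted ltn (u ++ map L q) /\ hat G (fs (u ++ map L q)).
Proof.
have [_ [heF _ _] _] := hF; have [_ [heG spG _] _] := hG.
elim/(well_founded_ind (regular_thin_wf hF)): t u => t IH u su hu le_tu.
have step n : exists mK : nat * (nat -> nat), forall q,
    sorted ltn (sq t ++ n :: q) -> hat F (fs (sq t ++ n :: q)) ->
    sorted ltn (u ++ mK.1 :: map mK.2 q) /\
    hat G (fs (u ++ mK.1 :: map mK.2 q)).
  have [[stn htn]|no] := pselect (sorted ltn (rcons (sq t) n) /\
                                  hat F (fs (rcons (sq t) n))); last first.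
    (* Placeholder values: by heredity no [q] satisfies the premises here. *)
    exists (0, id)%N => q; rewrite -cat_rcons => s1 h1; case: no; split.
      by case: (cat_sorted2 s1).
    by apply: hat_sub h1 => // x xp; rewrite mem_cat xp.
  have ext : extends_in F (fs (rcons (sq t) n)) t.
    split=> //; split.
      rewrite -{1}[t]fset_sortK -cats1; apply: initial_segment_cat.
      by rewrite cats1.
    move=> tE; have := congr1 (fun s => size (sq s)) tE.
    by rewrite sort_fset_seq // size_rcons => /eqP; rewrite ltn_eqF.
  move: (le_tu); rewrite node_rankE [node_rank hG _]node_rankE /=.
  move=> /(_ (exist (extends_in F ^~ t) _ ext))[[w [hw [uw uNw]]] /= le_w].
  have [[|m r] wE] := sort_initial_segment uw.
    by case: uNw; rewrite -(fset_sortK w) wE cats0 fset_sortK.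
  move: wE; rewrite sort_fset_seq // => wE.
  have [||K homoK HK] := IH _ ext (sq w) (sort_fset_sorted w).
  - by rewrite fset_sortK.
  - by rewrite fset_sortK.
  exists (m, K) => q /= s1 h1.
  have [] := HK q; rewrite ?sort_fset_seq // ?cat_rcons // wE -catA /=.
  move=> s2 h2.
  (* Deleting [r] keeps the list increasing, and heredity keeps it in [hat G]. *)
  have sub : subseq (u ++ m :: map K q) (u ++ m :: r ++ map K q).
    by rewrite subseq_cat2l /= eqxx suffix_subseq.
  split; first exact: subseq_sorted ltn_trans _ _ sub s2.
  by apply: hat_sub h2 => //; exact: mem_subseq sub.
have [mK mKP] := choice step.
(* L k must exceed u, m_n and K_n(k) for all n <= k. *)
have [L homoL leL] := increasing_majorant
  (fun k => (sumn u).+1 + \sum_(n < k.+1) ((mK n).1 + (mK n).2 k))%N.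
have uL k x : x \in u -> (x < L k)%N.
  move=> xu; apply: leq_trans (leL k); rewrite addSn ltnS.
  apply: leq_trans (leq_addr _ _).
  elim: (u) xu => //= y v IHv; rewrite inE => /orP[/eqP->|/IHv].
    exact: leq_addr.
  by move=> /leq_trans; apply; exact: leq_addl.
have geL k n : (n <= k)%N -> ((mK n).1 <= L k)%N /\ ((mK n).2 k <= L k)%N.
  rewrite -ltnS => nk; suff le : ((mK n).1 + (mK n).2 k <= L k)%N.
    by split; apply: leq_trans le; rewrite ?leq_addr ?leq_addl.
  apply: leq_trans (leL k); apply: leq_trans (leq_addl _ _).
  by rewrite (bigD1 (Ordinal nk)) //= leq_addr.
exists L => // q sq_ hq.
have suL : sorted ltn (u ++ map L q).
  rewrite (sorted_pairwise ltn_trans) pairwise_cat -!(sorted_pairwise ltn_trans).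
  rewrite su (homo_sorted homoL) ?andbT /=; last first.
    by case: (cat_sorted2 sq_).
  by apply/allrelP => x y xu /mapP[z _ ->]; exact: uL.
split=> //; case: q sq_ hq suL => [|n q] sq_ hq suL; first by rewrite cats0.
have [s1 h1] := mKP n q sq_ hq.
(* Entries after [n] are at least [n], so the diagonal bound [geL] applies to them. *)
have nq z : z \in q -> (n <= z)%N.
  have : sorted ltn (n :: q).
    by case: (cat_sorted2 sq_).
  by move=> /= /(order_path_min ltn_trans)/allP nq /nq/ltnW.
apply: (hat_spread spG s1 suL _ _ h1); first by rewrite !size_cat /= !size_map.
move=> k; rewrite size_cat /= => ks; rewrite !nth_cat.
case: ltnP => // uk.
case kE: (k - size u)%N => [|k'] /=; first by have [] := geL n n (leqnn n).
have k'q : (k' < size q)%N.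
  move: ks; by rewrite -{1}(subnKC uk) ltn_add2l kE size_map.
rewrite !(nth_map 0%N) //.
by have [] := geL (nth 0 q k')%N n (nq _ (mem_nth 0%N k'q)).
Qed.

Lemma shift_of_o_rank_le (F G : set_family)
    (hF : regular_thin F) (hG : regular_thin G) :
  ord_le (o_rank hF) (o_rank hG) ->
  exists2 L : nat -> nat, {homo L : i j / (i < j)%N} &
    forall q, sorted ltn q -> hat F (fs q) -> hat G (fs (map L q)).
Proof.
move=> le; have [_ _ [s0 Gs0 _]] := hG.
have fs0 : fs [::] = fset0 by apply/fsetP => x; rewrite !inE.
have h0 : hat G (fs [::]).
  by exists s0; rewrite // fs0; split=> //; exact: fsub0set.
have [|||L homoL HL] := @shift_of_node_rank_le F G hF hG fset0 [::] => //.
  by rewrite fs0.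
exists L => // q sq_ hq.
have sort0 : sq fset0 = [::] by rewrite -fs0 sort_fset_seq.
by have [] := HL q; rewrite ?sort0.
Qed.

(** * Thinning out [M] *)

Lemma infinite_set_ge (M : set nat) a : infinite_set M ->
  exists2 b, M b & (a <= b)%N.
Proof.
move=> iM; apply: contrapT => H; apply: iM.
apply: (@sub_finite_set _ _ `I_a) (finite_II a) => b Mb /=.
by rewrite ltnNge; apply/negP => ab; apply: H; exists b.
Qed.

Section Thin.
Variables (F : set_family) (hF : regular_thin F).

(** The empty set is a proper initial segment of the nonempty member of [F], against thinness. *)
Lemma regular_thin_neq0 s : F s -> s <> fset0.
Proof.
move=> Fs s0; have [tF _ [s1 Fs1 s1N]] := hF.
apply: (tF s s1) => //; rewrite s0; split; last by apply/nesym.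
by split=> //; exact: fsub0set.
Qed.

(** A member of [F] properly extending [p] continues it by some [m]. Heredity keeps [p] followed by
    [m], and spreading allows any larger value in place of [m]. *)
Lemma hat_rcons_ge (p : seq nat) : sorted ltn p -> hat F (fs p) ->
  ~ F (fs p) -> exists m, forall n, (m <= n)%N ->
    sorted ltn (rcons p n) -> hat F (fs (rcons p n)).
Proof.
have [_ [heF spF _] _] := hF.
move=> sp [s Fs ps] nFp; have [q sE] := sort_initial_segment ps.
move: sE; rewrite sort_fset_seq //; case: q => [|m q] sE.
  by case: nFp; rewrite -[p]cats0 -sE fset_sortK.
exists m => n mn spn.
have subm : subseq (rcons p m) (sq s).
  by rewrite sE -cat_rcons prefix_subseq.
apply: (@hat_spread F (rcons p m)) => //.
- by apply: (subseq_sorted ltn_trans subm); exact: sort_fset_sorted.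
- by rewrite !size_rcons.
- move=> k _; rewrite !nth_rcons; case: ltnP => // _; by case: eqP.
apply: (@hat_sub F _ (sq s)) => //; first exact: mem_subseq subm.
by rewrite fset_sortK; exists s => //; split.
Qed.

(* By [hat_rcons_ge], an element of [hat F] outside F extends by every large
   enough n, but not by every larger n: hence the passage to a subsequence. *)
Lemma exists_admissible_subsequence (M : set nat) : infinite_set M ->
  exists mu : nat -> nat, [/\ {homo mu : i j / (i < j)%N},
    forall j, M (mu j) &
    forall p j, sorted ltn (rcons p (mu j)) ->
      (forall x, x \in p -> range mu x) ->
      hat F (fs p) -> ~ F (fs p) -> hat F (fs (rcons p (mu j)))].
Proof.
move=> iM.
have /choice[m mP] (s : {fset nat}) : exists m, hat F s -> ~ F s ->
    forall n, (m <= n)%N -> sorted ltn (rcons (sq s) n) ->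
    hat F (fs (rcons (sq s) n)).
  have [[h n]|no] := pselect (hat F s /\ ~ F s).
    have [|||m mP] := @hat_rcons_ge (sq s); rewrite ?fset_sortK //.
      exact: sort_fset_sorted.
    by exists m.
  by exists 0%N => h n; case: no.
(* [H k] bounds the thresholds [m s] of all sets [s] of numbers below [k] at once. *)
pose H k := \sum_(s <- fpowerset [fset i in iota 0 k]%fset) m s.
have /choice[c cP] a : exists b, M b /\ (a <= b)%N.
  by have [b] := infinite_set_ge a iM; exists b.
(* [c a] is an element of [M] at least [a]. Each new value exceeds the last one and passes the
   thresholds of all sets with entries up to the last one. *)
pose mu := fix mu j := if j is j'.+1 then c ((mu j').+1 + H (mu j').+1)%N
                       else c (H 0%N).
have muS j : ((mu j).+1 + H (mu j).+1 <= mu j.+1)%N.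
  exact: (cP _).2.
have homomu : {homo mu : i j / (i < j)%N}.
  apply: (homo_ltn ltn_trans) => i.
  by apply: leq_trans (muS i); rewrite leq_addr.
exists mu; split=> //; first by case=> [|j]; exact: (cP _).1.
move=> p j spj pmu hp nFp.
have := spj; rewrite (sorted_pairwise ltn_trans) pairwise_rcons => /andP[/allP pj].
rewrite -(sorted_pairwise ltn_trans) => sp.
have := mP _ hp nFp (mu j); rewrite sort_fset_seq //; apply=> //.
have sumH k : (forall x, x \in p -> x < k)%N -> (m (fs p) <= H k)%N.
  move=> pk; rewrite /H (big_fsetD1 (fs p)) /= ?leq_addr //.
  rewrite fpowersetE; apply/fsubsetP => x; rewrite !inE /= mem_iota.
  by move/pk.
case: j spj pj => [|j] _ pj.
  (* Nothing in the range of [mu] lies below [mu 0], so here [p] is empty. *)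
  apply: (@leq_trans (H 0%N)); last by case: (cP (H 0%N)).
  apply: sumH => x xp; have [i _ ix] := pmu _ xp.
  have := pj _ xp; rewrite -ix; case: i {ix} => [|i]; first by rewrite ltnn.
  by move=> /(ltn_trans (homomu 0 i.+1 isT))%N; rewrite ltnn.
(* Entries of [p] are values of [mu] below [mu j.+1], hence at most [mu j]. *)
apply: leq_trans (muS j); apply: leq_trans (leq_addl _ _).
apply: sumH => x xp; have [i _ ix] := pmu _ xp.
have := pj _ xp; rewrite -ix ltnS (leqW_mono (leq_mono homomu)).
by rewrite ltnS (leq_mono homomu).
Qed.

End Thin.

(** * Initial segments of members of [G] coming from [F] *)

Section Transfer.
Variables (F G : set_family) (hF : regular_thin F) (hG : regular_thin G).
Variables (L mu : nat -> nat).
Hypothesis homoL : {homo L : i j / (i < j)%N}.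
Hypothesis homomu : {homo mu : i j / (i < j)%N}.
Hypothesis HL : forall q, sorted ltn q -> hat F (fs q) -> hat G (fs (map L q)).
Hypothesis Hmu : forall p j, sorted ltn (rcons p (mu j)) ->
  (forall x, x \in p -> range mu x) ->
  hat F (fs p) -> ~ F (fs p) -> hat F (fs (rcons p (mu j))).

(** Read [u] from the left: as long as no prefix is in [F], [Hmu] keeps the next one in [hat F]. The
    empty list starts in [hat F] and outside [F]. *)
Lemma prefix_in_or_hat (u : seq nat) : sorted ltn u ->
  (forall x, x \in u -> range mu x) ->
  (exists2 p, prefix p u & F (fs p)) \/ (hat F (fs u) /\ ~ F (fs u)).
Proof.
elim/last_ind: u => [_ _|u n IH sun umu].
  have fs0 : fs [::] = fset0 by apply/fsetP => x; rewrite !inE.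
  right; split; last by move=> /(regular_thin_neq0 hF).
  have [_ _ [s Fs _]] := hF; exists s => //; rewrite fs0.
  by split=> //; exact: fsub0set.
have su : sorted ltn u by move: sun; rewrite -cats1 => /cat_sorted2[].
have umu' : (forall x, x \in u -> range mu x).
  by move=> x xu; apply: umu; rewrite mem_rcons inE xu orbT.
have [[p pu Fp]|[hu nFu]] := IH su umu'.
  by left; exists p => //; apply: prefix_trans pu (prefix_rcons _ _).
have [Fun|nFun] := pselect (F (fs (rcons u n))).
  by left; exists (rcons u n) => //; exact: prefix_refl.
right; split=> //.
have [j _ jn] : range mu n.
  by apply: umu; rewrite mem_rcons mem_head.
by rewrite -jn; apply: Hmu => //; rewrite jn.
Qed.

Lemma shifted_initial_segment t : restrict_family G (range (L \o mu)) t ->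
  exists s, restrict_family F (range mu) s /\ prefix (map L (sq s)) (sq t).
Proof.
move=> [Gt tK].
have ltL := leqW_mono (leq_mono homoL).
have [u umu tE] : exists2 u, (forall x, x \in u -> range mu x) &
    sq t = map L u.
  have : {subset sq t <= t} by move=> x; rewrite mem_sort.
  elim: (sq t) => [|n l IH] lt; first by exists [::].
  have [|u umu ->] := IH; first by move=> x xl; apply: lt; rewrite inE xl orbT.
  have [j _ jn] := tK n (lt n (mem_head _ _)).
  exists (mu j :: u) => [x|]; last by rewrite /= -jn.
  by rewrite inE => /orP[/eqP->|/umu //]; exists j.
have su : sorted ltn u.
  by have := sort_fset_sorted t; rewrite tE sorted_map (eq_sorted ltL).
have [[p pu Fp]|[[v Fv uv] nFu]] := prefix_in_or_hat su umu.
  have sp : sorted ltn p.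
    by case/prefixP: pu su => q -> /cat_sorted2[].
  case/prefixP: pu tE umu => q -> tE umu.
  exists (fs p); rewrite sort_fset_seq // tE map_cat prefix_prefix.
  split=> //; split=> // x /=; rewrite in_fset_seq => xp.
  by apply: umu; rewrite mem_cat xp.
have [thinG _ _] := hG.
have [q vE] := sort_initial_segment uv; rewrite sort_fset_seq // in vE.
have [|w Gw Lvw] := HL (sort_fset_sorted v).
  by rewrite fset_sortK; exists v.
(* [t] is an initial segment of L(v), hence of [w] in [G]. If [t] were equal to [w], sizes would
   leave no room for [q], so [u] would list [v], a member of [F]. *)
case: (thinG t w) => //; split.
  apply: initial_segment_trans Lvw; rewrite -(fset_sortK t) vE tE map_cat.
  apply: initial_segment_cat; rewrite -map_cat -vE.
  by apply: homo_sorted (sort_fset_sorted v).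
move=> tw; apply: nFu; suff -> : u = sq v by rewrite fset_sortK.
have [r wE] := sort_initial_segment Lvw.
move: wE; rewrite sort_fset_seq; last first.
  by apply: homo_sorted (sort_fset_sorted v).
rewrite -tw tE vE map_cat -catA => /(congr1 size)/eqP.
rewrite !size_cat size_map -[X in X == _]addn0 eqn_add2l eq_sym addn_eq0.
by rewrite size_map size_eq0 => /andP[/eqP-> _]; rewrite cats0.
Qed.

End Transfer.

(** Entries of [s] are sent by [L] to the entries of [t] at the same positions, and a strictly
    increasing [L] reflects [<]. Nonemptiness does not pass to prefixes, so it is assumed
    separately. *)
Lemma plegma_shifted_prefix (L : nat -> nat) k (s t : 'I_k -> {fset nat}) :
  {homo L : i j / (i < j)%N} -> (forall i, s i <> fset0) ->
  (forall i, prefix (map L (sq (s i))) (sq (t i))) ->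
  plegma t -> plegma s.
Proof.
move=> homoL s0 st [_ t1 t2].
have ltL := leqW_mono (leq_mono homoL).
have size_st i : (#|` s i| <= #|` t i|)%N.
  by have := size_prefix (st i); rewrite size_map !size_sort.
have elt_st i m : (m < #|` s i|)%N -> elt (t i) m = L (elt (s i) m).
  move=> ms; have /prefixP[q tE] := st i.
  by rewrite /elt tE nth_cat size_map size_sort ms (nth_map 0%N) // size_sort.
split=> // i j m => [ij|] mi mj; rewrite -ltL -!elt_st //.
  by apply: t1 => //; apply: leq_trans (size_st _).
by apply: t2 => //; apply: leq_trans (size_st _).
Qed.

(** * Increasing enumerations *)

Lemma min_ofP (A : set nat) m : A m ->
  A (min_of A) /\ forall n, A n -> (min_of A <= n)%N.
Proof.
move=> Am; rewrite /min_of; case: xgetP => [_ _ [] //|].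
have exA : exists n, `[< A n >] by exists m; apply/asboolP.
have [n /asboolP An nmin] := ex_minnP exA.
by move=> /(_ n)[]; split=> // i Ai; apply: nmin; apply/asboolP.
Qed.

(** By induction [g l.+1] exceeds [enumset M l], so it competes in the minimum defining the next
    element. *)
Lemma enumset_le (M : set nat) (g : nat -> nat) :
  {homo g : i j / (i < j)%N} -> (forall l, M (g l)) ->
  forall l, (enumset M l <= g l)%N.
Proof.
move=> homog Mg; elim=> [|l IH] /=; first by case: (min_ofP (Mg 0%N)) => _; apply.
have lg : (M `&` [set n | (enumset M l < n)%N]) (g l.+1).
  by split=> //=; apply: leq_ltn_trans IH _; exact: homog.
by case: (min_ofP lg) => _; apply.
Qed.

Lemma enumset_range (g : nat -> nat) :
  {homo g : i j / (i < j)%N} -> forall l, enumset (range g) l = g l.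
Proof.
move=> homog l; apply/eqP; rewrite eqn_leq enumset_le //=; last first.
  by move=> j; exists j.
have leg := leq_mono homog; have ltg := leqW_mono leg.
elim: l => [|l IH] /=.
  have [[i _ <-] _] : range g (min_of (range g)) /\ _ :=
    min_ofP (ex_intro2 _ _ 0%N I erefl).
  by rewrite leg.
have lg : (range g `&` [set n | (enumset (range g) l < n)%N]) (g l.+1).
  split; first by exists l.+1.
  apply: leq_ltn_trans (homog l _ (leqnn _)).
  by apply: enumset_le => // j; exists j.
have [[[i _ <-] /= li] _] := min_ofP lg.
by rewrite leg -ltg (leq_ltn_trans IH li).
Qed.

(** * Comparison of spreading models *)

Lemma spreading_model_of_o_rank_le (R : realType) (X : normedModType R)
    (F G : set_family) (hF : regular_thin F) (hG : regular_thin G)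
    (E : lmodType R) (nu : E -> R) (e : nat -> E) :
  ord_le (o_rank hF) (o_rank hG) ->
  spreading_model X nu e F -> spreading_model X nu e G.
Proof.
move=> le_FG [x [M [iM [delta [delta_gt0 delta0 gen]]]]].
have [L homoL HL] := shift_of_o_rank_le le_FG.
have [mu [homomu Mmu Hmu]] := exists_admissible_subsequence hF iM.
have homog : {homo L \o mu : i j / (i < j)%N} by move=> i j ij; exact/homoL/homomu.
have /choice[c cP] (t : {fset nat}) : exists s : {fset nat},
    restrict_family G (range (L \o mu)) t ->
    restrict_family F (range mu) s /\ prefix (map L (sq s)) (sq t).
  have [Gt|nGt] := pselect (restrict_family G (range (L \o mu)) t).
    have [s Hs] := shifted_initial_segment hF hG homoL HL Hmu Gt.
    by exists s.
  (* Off the restricted family the value of [c] is arbitrary. *)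
  by exists t.
exists (x \o c), (range (L \o mu)); split.
  move=> finK; apply: infinite_nat.
  have := finite_preimage (in2W (incn_inj (leq_mono homog))) finK.
  by rewrite preimage_range.
(* The error sequence is unchanged: the new vectors are those of [x] at the plegma tuple of the
   [c (t j)]. *)
exists delta; split=> // k l kl t plt Gt lt0 a aP.
have c0 j : c (t j) <> fset0.
  by apply: (regular_thin_neq0 hF); case: (cP _ (Gt j)) => -[].
have ct j := (cP _ (Gt j)).2.
apply: gen => //.
- exact: (plegma_shifted_prefix homoL c0 ct plt).
- move=> j; have [[Fc cmu] _] := cP _ (Gt j); split=> // i /cmu[n _ <-].
  exact: Mmu.
(* M(l) is at most [mu l], which is at most the first entry of [c (t ord0)], because [L] maps that
   entry to the first entry of [t ord0], which is at least [L (mu l)]. *)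
apply: leq_trans (enumset_le homomu Mmu l) _.
rewrite -(leq_mono homoL).
have -> : L (elt (c (t ord0)) 0) = elt (t ord0) 0.
  have /prefixP[q tE] := ct ord0.
  have : (0 < #|` c (t ord0)|)%N by rewrite cardfs_gt0; apply/eqP/c0.
  rewrite /elt tE nth_cat size_map size_sort => c1.
  by rewrite c1 (nth_map 0%N) // size_sort.
by move: lt0; rewrite (enumset_range homog).
Qed.

Theorem proposition0p2 (R : realType) (X : completeNormedModType R)
    (F G : set_family) (hF : regular_thin F) (hG : regular_thin G)
    (E : lmodType R) (nu : E -> R) (e : nat -> E)
    (hnu : seminorm nu) (he : hamel_basis e) :
  (ord_eq (o_rank hF) (o_rank hG) ->
     (spreading_model X nu e F <-> spreading_model X nu e G)) /\
  (ord_le (o_rank hF) (o_rank hG) ->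
     spreading_model X nu e F -> spreading_model X nu e G).
Proof.
split=> [[leFG leGF]|leFG]; first split.
- exact: (spreading_model_of_o_rank_le leFG).
- exact: (spreading_model_of_o_rank_le leGF).
- exact: (spreading_model_of_o_rank_le leFG).
Qed.
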